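(* Let $ABC$ be a nondegenerate triangle with $a=|BC|$, $b=|CA|$, $c=|AB|$, area $S$, circumcenter $O$, circumradius $R$ and symmedian point $X_6$. Then $$\left(a^2+b^2+c^2-4\sqrt3\,S\right)\left(a^2+b^2+c^2+4\sqrt3\,S\right)=\frac{(a^2+b^2+c^2)^2}{R^2}|OX_6|^2\ \ge\ 0 .$$
   Context: The symmedian point $X_6$ ($X(6)$ in the Encyclopedia of Triangle Centers) is the point $(a^2A+b^2B+c^2C)/(a^2+b^2+c^2)$, i.e. the point with homogeneous barycentric coordinates $a^2:b^2:c^2$ with respect to $ABC$. *)

(* Defs.v *)
From HB Require Import structures.
From mathcomp Require Import all_boot all_order all_algebra.
From mathcomp Require Import reals.

Set Implicit Arguments.
Unset Strict Implicit.
Unset Printing Implicit Defensive.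

Import Order.TTheory GRing.Theory Num.Theory.
Local Open Scope ring_scope.

(* Points of the Euclidean plane are row vectors 'rV[R]_2.  The distance is
   spelled out because the library norm on matrices is the sup norm. *)
Definition edist (R : realType) (P Q : 'rV[R]_2) : R :=
  Num.sqrt (\sum_(i < 2) (P 0 i - Q 0 i) ^+ 2).

Definition edges (R : realType) (A B C : 'rV[R]_2) : 'M[R]_2 :=
  col_mx (B - A) (C - A).

(* A, B, C are affinely independent, i.e. not collinear. *)
Definition nondegenerate_triangle (R : realType) (A B C : 'rV[R]_2) : bool :=
  row_free (edges A B C).

Definition triangle_area (R : realType) (A B C : 'rV[R]_2) : R :=
  `|\det (edges A B C)| / 2.

(* The circle of center O and radius r passes through the three vertices;
   for a nondegenerate triangle this determines O and r. *)
Definition is_circumcircle (R : realType) (A B C O : 'rV[R]_2) (r : R) : Prop :=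
  [/\ edist O A = r, edist O B = r & edist O C = r].

Definition symmedian_point (R : realType) (A B C : 'rV[R]_2) : 'rV[R]_2 :=
  let a := edist B C in
  let b := edist C A in
  let c := edist A B in
  (a ^+ 2 + b ^+ 2 + c ^+ 2)^-1 *: (a ^+ 2 *: A + b ^+ 2 *: B + c ^+ 2 *: C).

(* Main.v *)
Require Import Defs.
From mathcomp Require Import all_boot all_order all_algebra.
From mathcomp Require Import reals.
From mathcomp Require Import ring lra.
Import Order.TTheory GRing.Theory Num.Theory.
Local Open Scope ring_scope.

(** Lagrange's identity for the point with barycentric weights a^2 : b^2 : c^2
    gives (a^2 + b^2 + c^2)^2 |OX6|^2 = (a^2 + b^2 + c^2)^2 r^2 - 3 (a b c)^2,
    and a b c = 4 r S turns the last term, divided by r^2, into 48 S^2, which is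
    the product of 4 sqrt 3 S with itself. *)

Lemma sqr_edist (R : realType) (P Q : 'rV[R]_2) :
  edist P Q ^+ 2 = (P 0 0 - Q 0 0) ^+ 2 + (P 0 1 - Q 0 1) ^+ 2.
Proof.
rewrite /edist sqr_sqrtr; last by apply: sumr_ge0 => i _; exact: sqr_ge0.
rewrite big_ord_recl big_ord1.
by have -> : lift ord0 ord0 = 1 :> 'I_2 by apply: val_inj.
Qed.

Lemma edges_row0 (R : realType) (A B C : 'rV[R]_2) j :
  edges A B C 0 j = B 0 j - A 0 j.
Proof.
(* The index [0] of ['I_2] agrees with [lshift 1 0] in value only, and [col_mxEu] needs the latter
   form. *)
transitivity (col_mx (B - A) (C - A) (lshift 1 0) j); last by rewrite col_mxEu !mxE.
by congr (fun_of_matrix _ _ _); apply: val_inj.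
Qed.

Lemma edges_row1 (R : realType) (A B C : 'rV[R]_2) j :
  edges A B C 1 j = C 0 j - A 0 j.
Proof.
transitivity (col_mx (B - A) (C - A) (rshift 1 0) j); last by rewrite col_mxEd !mxE.
by congr (fun_of_matrix _ _ _); apply: val_inj.
Qed.

Lemma det_mx22 (R : comNzRingType) (M : 'M[R]_2) :
  \det M = M 0 0 * M 1 1 - M 0 1 * M 1 0.
Proof.
rewrite (expand_det_row _ 0) big_ord_recl big_ord1 /cofactor !det_mx11 !mxE /=.
have -> : lift ord0 ord0 = 1 :> 'I_2 by apply: val_inj.
have -> : lift 1 0 = 0 :> 'I_2 by apply: val_inj.
by ring.
Qed.

Lemma det_edges (R : realType) (A B C : 'rV[R]_2) :
  \det (edges A B C) =
  (B 0 0 - A 0 0) * (C 0 1 - A 0 1) - (B 0 1 - A 0 1) * (C 0 0 - A 0 0).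
Proof. by rewrite det_mx22 !edges_row0 !edges_row1. Qed.

Lemma sqr_triangle_area (R : realType) (A B C : 'rV[R]_2) :
  4 * triangle_area A B C ^+ 2 = \det (edges A B C) ^+ 2.
Proof. by rewrite /triangle_area expr_div_n real_normK ?num_real //; field. Qed.

Lemma edist_eq0 (R : realType) (P Q : 'rV[R]_2) : (edist P Q == 0) = (P == Q).
Proof.
rewrite -sqrf_eq0 sqr_edist paddr_eq0 ?sqr_ge0 // !sqrf_eq0 !subr_eq0.
apply/andP/eqP => [[/eqP h0 /eqP h1]|-> //].
apply/rowP; case=> [[|[|//]] i_lt].
  by rewrite (_ : Ordinal i_lt = 0) //; apply: val_inj.
by rewrite (_ : Ordinal i_lt = 1) //; apply: val_inj.
Qed.

(** If [A = B], the first row of [edges] vanishes, and so does the determinant. This keeps both [r]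
    and the sum of squared sides away from zero. *)
Lemma nondegenerate_triangle_neq (R : realType) (A B C : 'rV[R]_2) :
  nondegenerate_triangle A B C -> A != B.
Proof.
rewrite /nondegenerate_triangle row_free_unit unitmxE unitfE det_edges.
by apply: contraNneq => ->; rewrite !subrr !mul0r subrr.
Qed.

(** The formula [abc = 4rS] in squared form, which is polynomial in the coordinates: no square
    roots, no sign of the determinant. *)
Lemma circumradius_area (R : realType) (A B C O : 'rV[R]_2) (r : R) :
  is_circumcircle A B C O r ->
  16 * triangle_area A B C ^+ 2 * r ^+ 2 =
  edist B C ^+ 2 * edist C A ^+ 2 * edist A B ^+ 2.
Proof.
move=> [hA hB hC].
have -> : 16 * triangle_area A B C ^+ 2 = 4 * \det (edges A B C) ^+ 2.
  by rewrite -sqr_triangle_area; ring.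
have hAB : edist O A ^+ 2 = edist O B ^+ 2 by rewrite hA hB.
have hAC : edist O A ^+ 2 = edist O C ^+ 2 by rewrite hA hC.
rewrite -hA det_edges; move: hAB hAC; rewrite !sqr_edist.
(* Take [A] as origin: [e], [f], [o] are the vectors from [A] to [B], [C], [O]. *)
set e0 := B 0 0 - A 0 0; set e1 := B 0 1 - A 0 1.
set f0 := C 0 0 - A 0 0; set f1 := C 0 1 - A 0 1.
set o0 := O 0 0 - A 0 0; set o1 := O 0 1 - A 0 1.
have -> : O 0 0 - B 0 0 = o0 - e0 by rewrite /o0 /e0; ring.
have -> : O 0 1 - B 0 1 = o1 - e1 by rewrite /o1 /e1; ring.
have -> : O 0 0 - C 0 0 = o0 - f0 by rewrite /o0 /f0; ring.
have -> : O 0 1 - C 0 1 = o1 - f1 by rewrite /o1 /f1; ring.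
have -> : B 0 0 - C 0 0 = e0 - f0 by rewrite /e0 /f0; ring.
have -> : B 0 1 - C 0 1 = e1 - f1 by rewrite /e1 /f1; ring.
have -> : A 0 0 - B 0 0 = - e0 by rewrite /e0; ring.
have -> : A 0 1 - B 0 1 = - e1 by rewrite /e1; ring.
move: e0 e1 f0 f1 o0 o1 => e0 e1 f0 f1 o0 o1 hAB hAC.
(* The squares of [o] cancel, leaving the linear equations of the perpendicular bisectors of [AB]
   and [AC]. *)
have he : 2 * (o0 * e0 + o1 * e1) = e0 ^+ 2 + e1 ^+ 2 by lra.
have hf : 2 * (o0 * f0 + o1 * f1) = f0 ^+ 2 + f1 ^+ 2 by lra.
(* Cramer's rule for the linear system he, hf in o0, o1 *)
have ho0 : 2 * o0 * (e0 * f1 - e1 * f0) =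
    (e0 ^+ 2 + e1 ^+ 2) * f1 - (f0 ^+ 2 + f1 ^+ 2) * e1 by rewrite -he -hf; ring.
have ho1 : 2 * o1 * (e0 * f1 - e1 * f0) =
    (f0 ^+ 2 + f1 ^+ 2) * e0 - (e0 ^+ 2 + e1 ^+ 2) * f0 by rewrite -he -hf; ring.
transitivity ((2 * o0 * (e0 * f1 - e1 * f0)) ^+ 2
              + (2 * o1 * (e0 * f1 - e1 * f0)) ^+ 2); first by ring.
(* What remains is that the vector [|e|^2 f - |f|^2 e] has squared length
   [|e|^2 |f|^2 |e - f|^2]. *)
by rewrite ho0 ho1; ring.
Qed.

Lemma circumradius_neq0 (R : realType) (A B C O : 'rV[R]_2) (r : R) :
  nondegenerate_triangle A B C -> is_circumcircle A B C O r -> r != 0.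
Proof.
move=> /nondegenerate_triangle_neq hAB [hA hB _]; apply: contraNneq hAB => r0.
have /eqP <- : O == A by rewrite -edist_eq0 hA r0.
by rewrite -edist_eq0 hB r0.
Qed.

(** With [u], [v], [w] the vectors from [O] to the vertices, expand [|xu + yv + zw|^2] and replace
    each [2 u.v] by [|u|^2 + |v|^2 - |u - v|^2]. *)
Lemma lagrange_barycenter (R : realType) (A B C O : 'rV[R]_2) (x y z : R) :
  x + y + z != 0 ->
  (x + y + z) ^+ 2
    * edist O ((x + y + z)^-1 *: (x *: A + y *: B + z *: C)) ^+ 2 =
  (x + y + z) * (x * edist O A ^+ 2 + y * edist O B ^+ 2 + z * edist O C ^+ 2)
  - (y * z * edist B C ^+ 2 + z * x * edist C A ^+ 2 + x * y * edist A B ^+ 2).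
Proof. by move=> s0; rewrite !sqr_edist !mxE; field. Qed.

Theorem mainTheorem11 (R : realType) (A B C O : 'rV[R]_2) (r : R)
    (hABC : nondegenerate_triangle A B C) (hO : is_circumcircle A B C O r) :
  let a := edist B C in
  let b := edist C A in
  let c := edist A B in
  let S := triangle_area A B C in
  let X6 := symmedian_point A B C in
  (a ^+ 2 + b ^+ 2 + c ^+ 2 - 4 * Num.sqrt 3 * S)
    * (a ^+ 2 + b ^+ 2 + c ^+ 2 + 4 * Num.sqrt 3 * S)
  = (a ^+ 2 + b ^+ 2 + c ^+ 2) ^+ 2 / r ^+ 2 * edist O X6 ^+ 2
  /\ 0 <= (a ^+ 2 + b ^+ 2 + c ^+ 2) ^+ 2 / r ^+ 2 * edist O X6 ^+ 2.
Proof.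
move=> a b c S X6.
have r0 : r != 0 := circumradius_neq0 _ _ _ _ _ _ hABC hO.
have s0 : a ^+ 2 + b ^+ 2 + c ^+ 2 != 0.
  have c0 : c != 0 by rewrite edist_eq0 (nondegenerate_triangle_neq _ _ _ _ hABC).
  by rewrite gt_eqF // ltr_wpDl ?addr_ge0 ?sqr_ge0 // exprn_even_gt0.
split; last by rewrite mulr_ge0 ?divr_ge0 ?sqr_ge0.
have hS : 16 * S ^+ 2 * r ^+ 2 = a ^+ 2 * b ^+ 2 * c ^+ 2.
  exact: circumradius_area hO.
have hX : (a ^+ 2 + b ^+ 2 + c ^+ 2) ^+ 2 * edist O X6 ^+ 2 =
    (a ^+ 2 + b ^+ 2 + c ^+ 2) ^+ 2 * r ^+ 2 - 3 * (16 * S ^+ 2 * r ^+ 2).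
  case: hO => hA hB hC.
  (* With weights [a^2], [b^2], [c^2], each of the three subtracted products equals [a^2 b^2 c^2],
     hence the factor 3. *)
  by rewrite lagrange_barycenter // hA hB hC -/a -/b -/c hS; ring.
have h3 : Num.sqrt 3 ^+ 2 = 3 :> R by rewrite sqr_sqrtr.
(* The left side is a difference of squares; the right side reaches the same value once [r ^+ 2] is
   cancelled in [hX]. *)
transitivity ((a ^+ 2 + b ^+ 2 + c ^+ 2) ^+ 2 - 3 * (16 * S ^+ 2)).
  by ring: h3.
by rewrite mulrAC hX; field.
Qed.
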